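(* Let $(W,W')$ be an exchangeable pair of real random variables and set $\Delta = W-W'$. Suppose that $$E(W-W'\mid W) = g(W) + r(W)$$ for a differentiable function $g:\mathbb{R}\to\mathbb{R}$ and a measurable function $r$. Let $c_0>0$ be a constant, let $G(t)=\int_0^t g(s)\,ds$, assume $\int_{-\infty}^\infty e^{-c_0G(t)}dt<\infty$, let $c_1 = 1/\int_{-\infty}^\infty e^{-c_0 G(t)}\,dt$, and let $Y$ be a random variable with density $p(t)=c_1e^{-c_0G(t)}$. Assume: (H1) $g$ is non-decreasing, $g(t)\ge 0$ for $t>0$ and $g(t)\le 0$ for $t\le 0$; (H3) there is $c_3<\infty$ such that for all $x$, $\min\big(1/c_1, 1/|c_0 g(x)|\big)\,(|x| + 3/c_1)\, c_0|g'(x)| \le c_3$. Assume moreover that $|W-W'|\le \delta$ for a constant $\delta$. Then for all real $z$, $$|P(W\le z) - P(Y\le z)| \le 3E\big|1-(c_0/2)E(\Delta^2\mid W)\big| + c_1\max(1,c_3)\,\delta + \frac{2c_0}{c_1}E|r(W)| + \delta^3 c_0\Big\{\big(2 + \tfrac{c_3}{2}\big)E|c_0 g(W)| + \tfrac{c_1c_3}{2}\Big\}.$$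
   Context: A pair $(W,W')$ is exchangeable if $(W,W')$ and $(W',W)$ have the same joint distribution. In (H3), $1/|c_0g(x)|$ is interpreted as $+\infty$ when $g(x)=0$. *)

(* Defs.v *)
From HB Require Import structures.
From mathcomp Require Import all_boot all_order all_algebra.
From mathcomp Require Import all_classical all_reals all_analysis.
Set Implicit Arguments. Unset Strict Implicit. Unset Printing Implicit Defensive.
Import Order.TTheory GRing.Theory Num.Theory.
Import numFieldNormedType.Exports.
Local Open Scope classical_set_scope.
Local Open Scope ring_scope.

Definition primG (R : realType) (g : R -> R) (t : R) : R :=
  if 0 <= t then Rintegral lebesgue_measure `[0, t] g
  else - Rintegral lebesgue_measure `[t, 0] g.

Definition is_cond_exp (d : measure_display) (T : measurableType d) (R : realType)
  (P : probability T R) (W X : T -> R) (h : R -> R) : Prop :=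
  measurable_fun setT h /\
  P.-integrable setT (fun w => (X w)%:E) /\
  P.-integrable setT (fun w => (h (W w))%:E) /\
  forall B : set R, measurable B ->
    (\int[P]_(w in W @^-1` B) (X w)%:E = \int[P]_(w in W @^-1` B) (h (W w))%:E)%E.

Definition exchangeable (d : measure_display) (T : measurableType d) (R : realType)
  (P : probability T R) (W W' : T -> R) : Prop :=
  forall A : set (R * R), measurable A ->
    P ((fun w => (W w, W' w)) @^-1` A) = P ((fun w => (W' w, W w)) @^-1` A).

(* The bracket in (H3): min(1/c1, 1/|c0 g x|), with 1/0 read as +oo. *)
Definition h3_min (R : realType) (c0 c1 gx : R) : R :=
  if gx == 0 then 1 / c1 else Num.min (1 / c1) (1 / `|c0 * gx|).

(* Main.v *)
(* Stein's method with a shifted test point. Write u = c0 g, p for the density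
   of Y and F for its distribution function. The bounded solution f of
   f' - u f = 1_{]-oo, y]} - F y satisfies 0 <= f <= 1/c1, |u f| <= 1 and
   |f'| <= 1. Exchangeability gives 2 E[Delta f(W)] = E[Delta (f(W) - f(W'))], and
   f(W) - f(W') is compared with Delta f'(W) by a mean-value inequality. With
   y = z + delta (resp. z - delta) the jump of f' at y only helps in the bound of
   P(W <= z) - F y from above (resp. below), and F y - F z costs at most c1 delta
   since p <= c1; no concentration inequality for W is needed. The variation of
   u f over distance delta is controlled by (H3): when c1 max(1, c3) delta < 1
   (otherwise the claim is trivial) u varies by at most a constant factor, up to
   c1 c3, over such a distance. *)
Require Import Defs.
From HB Require Import structures.
From mathcomp Require Import all_boot all_order all_algebra.
From mathcomp Require Import all_classical all_reals all_analysis.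
From mathcomp Require Import measurable_realfun ring lra.
Set Implicit Arguments. Unset Strict Implicit. Unset Printing Implicit Defensive.
Import Order.TTheory GRing.Theory Num.Theory.
Import numFieldNormedType.Exports.
Local Open Scope classical_set_scope.
Local Open Scope ring_scope.

(** * Mean-value inequalities *)

Section slopes.
Context {R : realType}.
Implicit Types f g df : R -> R.

Lemma is_derive1_mul f g (x a b : R) :
  is_derive x 1 f a -> is_derive x 1 g b ->
  is_derive x 1 (fun t => f t * g t) (a * g x + f x * b).
Proof.
move=> fa gb; apply: (is_derive_eq (is_deriveM fa gb)).
by rewrite /GRing.scale/= addrC; congr (_ + _); rewrite mulrC.
Qed.

Lemma is_derive1_add f g (x a b : R) :
  is_derive x 1 f a -> is_derive x 1 g b ->
  is_derive x 1 (fun t => f t + g t) (a + b).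
Proof. by move=> fa gb; exact: (is_derive_eq (is_deriveD fa gb)). Qed.

Lemma is_derive1_opp f (x a : R) :
  is_derive x 1 f a -> is_derive x 1 (fun t => - f t) (- a).
Proof. by move=> fa; exact: (is_derive_eq (is_deriveN fa)). Qed.

Lemma is_derive1_scale f (x a k : R) :
  is_derive x 1 f a -> is_derive x 1 (fun t => k * f t) (k * a).
Proof. by move=> fa; exact: (is_derive_eq (is_deriveZ k fa)). Qed.

Lemma is_derive1_inv f (x a : R) : f x != 0 ->
  is_derive x 1 f a -> is_derive x 1 (fun t => (f t)^-1) (- (f x) ^- 2 * a).
Proof. by move=> fx0 fa; exact: (is_derive_eq (is_deriveV fx0 fa)). Qed.

Lemma is_derive1_continuous f (x a : R) :
  is_derive x 1 f a -> {for x, continuous f}.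
Proof.
by move=> fa; apply: differentiable_continuous; apply/derivable1_diffP/ex_derive.
Qed.

Lemma ge_slope f df (m a b : R) : a <= b ->
  {within `[a, b], continuous f} ->
  (forall x, a < x < b -> is_derive x 1 f (df x)) ->
  (forall x, a < x < b -> m <= df x) ->
  m * (b - a) <= f b - f a.
Proof.
move=> + cf fdf mdf; rewrite le_eqVlt => /predU1P[->|ab]; first by rewrite !subrr mulr0.
have fdf' x : x \in `]a, b[%R -> is_derive x 1 f (df x).
  by rewrite in_itv/=; exact: fdf.
have [c cab ->] := MVT ab fdf' cf.
by rewrite ler_wpM2r ?subr_ge0 ?(ltW ab)// mdf.
Qed.

(** The Stein solution has a kink at its test point, so one exceptional point [c] is allowed:
    continuity lets the increments over [a, c] and [c, b] be bounded separately and added. *)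
Lemma ge_slope_except f df (c m a b : R) : a <= b -> continuous f ->
  (forall x, x != c -> is_derive x 1 f (df x)) ->
  (forall x, a < x < b -> x != c -> m <= df x) ->
  m * (b - a) <= f b - f a.
Proof.
move=> ab cf fdf mdf.
have cfw (A : set R) : {within A, continuous f} by exact: continuous_subspaceT.
have [ca|ac] := leP c a.
  apply: (@ge_slope f df) => // x /andP[ax xb].
    by apply: fdf; rewrite gt_eqF// (le_lt_trans ca).
  by apply: mdf; rewrite ?ax// gt_eqF// (le_lt_trans ca).
have [bc|cb] := leP b c.
  apply: (@ge_slope f df) => // x /andP[ax xb].
    by apply: fdf; rewrite lt_eqF// (lt_le_trans xb).
  by apply: mdf; rewrite ?ax// lt_eqF// (lt_le_trans xb).
have h1 : m * (c - a) <= f c - f a.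
  apply: (@ge_slope f df); rewrite ?(ltW ac)// => x /andP[ax xc].
    by apply: fdf; rewrite lt_eqF.
  by apply: mdf; rewrite ?ax ?(lt_trans xc)// lt_eqF.
have h2 : m * (b - c) <= f b - f c.
  apply: (@ge_slope f df); rewrite ?(ltW cb)// => x /andP[cx xb].
    by apply: fdf; rewrite gt_eqF.
  by apply: mdf; rewrite ?xb ?(lt_trans ac)// gt_eqF.
lra.
Qed.

Lemma le_slope_except f df (c m a b : R) : a <= b -> continuous f ->
  (forall x, x != c -> is_derive x 1 f (df x)) ->
  (forall x, a < x < b -> x != c -> df x <= m) ->
  f b - f a <= m * (b - a).
Proof.
move=> ab cf fdf mdf.
suff : - m * (b - a) <= - f b - - f a by lra.
apply: (@ge_slope_except (fun x => - f x) (fun x => - df x) c) => //.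
- by move=> x; apply: continuousN; exact: cf.
- by move=> x /fdf /is_derive1_opp.
- by move=> x xab xc; rewrite lerN2 mdf.
Qed.

(** Multiplying the increment by [b - a] makes one statement serve both orders of [a] and [b]; this
    is the shape of [(W - W') * (f W - f W')]. *)
Lemma slope_except f df (c m1 m2 a b : R) : continuous f ->
  (forall x, x != c -> is_derive x 1 f (df x)) ->
  (forall x, `|x - a| <= `|b - a| -> x != c -> m1 <= df x <= m2) ->
  m1 * (b - a) ^+ 2 <= (b - a) * (f b - f a) <= m2 * (b - a) ^+ 2.
Proof.
move=> cf fdf mdf.
have [ab|/ltW ba] := leP a b.
  have nb x : a < x < b -> `|x - a| <= `|b - a|.
    by move=> /andP[? ?]; rewrite !ger0_norm; lra.
  have h1 : m1 * (b - a) <= f b - f a.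
    by apply: (@ge_slope_except f df c) => // x /nb xab /(mdf _ xab)/andP[].
  have h2 : f b - f a <= m2 * (b - a).
    by apply: (@le_slope_except f df c) => // x /nb xab /(mdf _ xab)/andP[].
  by apply/andP; split; nra.
have nb x : b < x < a -> `|x - a| <= `|b - a|.
  by move=> /andP[? ?]; rewrite !ler0_norm; lra.
have h1 : m1 * (a - b) <= f a - f b.
  by apply: (@ge_slope_except f df c) => // x /nb xab /(mdf _ xab)/andP[].
have h2 : f a - f b <= m2 * (a - b).
  by apply: (@le_slope_except f df c) => // x /nb xab /(mdf _ xab)/andP[].
by apply/andP; split; nra.
Qed.

Lemma normr_slope_except f df (c m a b : R) : continuous f ->
  (forall x, x != c -> is_derive x 1 f (df x)) ->
  (forall x, `|x - a| <= `|b - a| -> x != c -> `|df x| <= m) ->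
  `|f b - f a| <= m * `|b - a|.
Proof.
move=> cf fdf mdf.
have [->|ba] := eqVneq b a; first by rewrite !subrr normr0 mulr0.
have /andP[h1 h2] : - m * (b - a) ^+ 2 <= (b - a) * (f b - f a) <= m * (b - a) ^+ 2.
  by apply: (@slope_except f df c) => // x xab xc; rewrite -ler_norml; exact: mdf.
have ba0 : 0 < `|b - a| by rewrite normr_gt0 subr_eq0.
rewrite -(ler_pM2l ba0) -normrM mulrCA -expr2 real_normK ?num_real//.
by rewrite ler_norml h2 -mulNr h1.
Qed.

End slopes.

(** * The Stein equation *)

(* In the application [u = c0 g], [p] is the density of [Y] and [F] its
   distribution function. *)
Record target_law (R : realType) (c1 : R) (u du p F : R -> R) : Prop := TargetLaw {
  drift_nondecreasing : {homo u : x y / x <= y} ;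
  drift_ge0 : forall t : R, 0 < t -> 0 <= u t ;
  drift_le0 : forall t : R, t < 0 -> u t <= 0 ;
  drift_derive : forall x : R, is_derive x 1 u (du x) ;
  density_gt0 : forall x : R, 0 < p x ;
  density_derive : forall x : R, is_derive x 1 p (- (u x * p x)) ;
  density0 : p 0 = c1 ;
  cdf_derive : forall x : R, is_derive x 1 F (p x) ;
  cdf_bound : forall x : R, 0 <= F x <= 1 ;
  cdf_cvgy : forall e x : R, 0 < e -> exists2 y : R, x <= y & 1 - F y <= e ;
  cdf_cvgNy : forall e x : R, 0 < e -> exists2 y : R, y <= x & F y <= e }.

Section stein_solution.
Context {R : realType} {c1 : R} {u du p F : R -> R}.
Implicit Types x y : R.
Hypothesis law : target_law c1 u du p F.

Let p_gt0 := density_gt0 law.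
Let dp := density_derive law.
Let dF := cdf_derive law.
Let F01 := cdf_bound law.
Let u_homo := drift_nondecreasing law.
Let ddu := drift_derive law.

Let p_cont : continuous p.
Proof. by move=> x; exact: is_derive1_continuous (dp x). Qed.

Let F_cont : continuous F.
Proof. by move=> x; exact: is_derive1_continuous (dF x). Qed.

Let u_cont : continuous u.
Proof. by move=> x; exact: is_derive1_continuous (ddu x). Qed.

Lemma norm_const_gt0 : 0 < c1.
Proof. by rewrite -(density0 law). Qed.

Lemma cdf_nd : {homo F : x y / x <= y}.
Proof.
move=> x y xy; rewrite -subr_ge0.
have := @ge_slope _ F p 0 x y xy (continuous_subspaceT F_cont).
by rewrite mul0r; apply=> // t _; exact: ltW.
Qed.

(* Freezing the drift at [x] makes [p - u x (1 - F)] nonincreasing on [x, +oo[,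
   and its lower limit at infinity is nonnegative. *)
Lemma drift_upper_tail x : 0 <= u x -> u x * (1 - F x) <= p x.
Proof.
move=> ux0; rewrite leNgt; apply/negP => lt_p.
(* The assumed excess equals [e * (u x + 1)], which exceeds [u x * e], the most that a remaining
   tail of mass [e] can account for. The [+ 1] also covers [u x = 0]. *)
pose e := (u x * (1 - F x) - p x) / (u x + 1).
have u1 : 0 < u x + 1 by rewrite ltr_wpDl.
have e0 : 0 < e by rewrite divr_gt0 ?subr_gt0.
have [y xy Fy] := cdf_cvgy law x e0.
have : 0 * (y - x) <= (- p y + u x * - F y) - (- p x + u x * - F x).
  pose f t := - p t + u x * - F t.
  have df (t : R) : is_derive t 1 f (- - (u t * p t) + u x * - p t).
    by apply: is_derive1_add; [exact: is_derive1_opp|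
       apply: is_derive1_scale; exact: is_derive1_opp].
  apply: (@ge_slope _ f _ _ _ _ xy) => // [|t /andP[xt _]].
    by apply: continuous_subspaceT => t; exact: is_derive1_continuous (df t).
  by rewrite opprK mulrN subr_ge0 ler_wpM2r ?(ltW (p_gt0 _))//; exact/u_homo/ltW.
have : u x * (1 - F y) <= u x * e by rewrite ler_wpM2l.
have ee : e * (u x + 1) = u x * (1 - F x) - p x by rewrite divfK// gt_eqF.
have := p_gt0 y; lra.
Qed.

(** Mirror image of the upper tail: with the drift frozen at [x], [p + u x * F] is nondecreasing on
    ]-oo, x], and its lower limit at -oo is nonnegative. *)
Lemma drift_lower_tail x : u x <= 0 -> - u x * F x <= p x.
Proof.
move=> ux0; rewrite leNgt; apply/negP => lt_p.
pose e := (- u x * F x - p x) / (- u x + 1).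
have u1 : 0 < - u x + 1 by rewrite ltr_wpDl// oppr_ge0.
have e0 : 0 < e by rewrite divr_gt0 ?subr_gt0.
have [y yx Fy] := cdf_cvgNy law x e0.
have : 0 * (x - y) <= (p x + u x * F x) - (p y + u x * F y).
  pose f t := p t + u x * F t.
  have df (t : R) : is_derive t 1 f (- (u t * p t) + u x * p t).
    by apply: is_derive1_add; [exact: dp|exact: is_derive1_scale].
  apply: (@ge_slope _ f _ _ _ _ yx) => // [|t /andP[_ tx]].
    by apply: continuous_subspaceT => t; exact: is_derive1_continuous (df t).
  by rewrite addrC subr_ge0 ler_wpM2r ?(ltW (p_gt0 _))//; exact/u_homo/ltW.
have : - u x * F y <= - u x * e by rewrite ler_wpM2l// oppr_ge0.
have ee : e * (- u x + 1) = - u x * F x - p x by rewrite divfK// gt_eqF.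
have := p_gt0 y; lra.
Qed.

Let dV x : is_derive x 1 (fun t => (p t)^-1) (u x * (p x)^-1).
Proof.
have p0 : p x != 0 by rewrite gt_eqF.
apply: (is_derive_eq (is_derive1_inv p0 (dp x))).
by rewrite mulNr mulrN opprK; field.
Qed.

(* The Mills ratio [(1 - F) / p] is nonincreasing on the right half-line. *)
Lemma upper_tail_le x : 0 <= x -> c1 * (1 - F x) <= p x.
Proof.
move=> x0.
pose f t := (F t - 1) * (p t)^-1.
have df (t : R) : is_derive t 1 f (p t * (p t)^-1 + (F t - 1) * (u t * (p t)^-1)).
  apply: is_derive1_mul => //.
  rewrite -[p t]addr0; apply: is_derive1_add => //; exact: is_derive_cst.
have : 0 * (x - 0) <= f x - f 0.
  apply: (@ge_slope _ f _ _ _ _ x0) => // [|t /andP[t0 _]].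
    by apply: continuous_subspaceT => t; exact: is_derive1_continuous (df t).
  have /drift_upper_tail ut : 0 <= u t by exact: (drift_ge0 law t0).
  have -> : p t * (p t)^-1 + (F t - 1) * (u t * (p t)^-1) =
            (p t - u t * (1 - F t)) / p t by ring.
  by rewrite divr_ge0 ?subr_ge0// ltW.
(* At 0 the ratio [(1 - F) / p] is at most [1 / c1], because [p 0 = c1]. *)
rewrite mul0r /f (density0 law) => h.
have c10 := norm_const_gt0.
have /andP[F0 F1] := F01 0.
have Fx : (F x - 1) / p x * p x = F x - 1 by rewrite divfK// gt_eqF.
have h0 : (F 0 - 1) / c1 * c1 = F 0 - 1 by rewrite divfK// gt_eqF.
have hc : (F 0 - 1) / c1 >= - 1 / c1 by rewrite ler_pM2r ?invr_gt0//; lra.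
have : - 1 / c1 * p x <= (F x - 1) / p x * p x.
  rewrite ler_pM2r//; lra.
rewrite Fx -(ler_pM2l c10) mulrA mulrCA divff ?gt_eqF// mulr1; lra.
Qed.

(** By [drift_lower_tail] the ratio [F / p] is nondecreasing on the left half-line, and at 0 it is
    at most [1 / c1]. *)
Lemma lower_tail_le x : x <= 0 -> c1 * F x <= p x.
Proof.
move=> x0.
pose f t := F t * (p t)^-1.
have df (t : R) : is_derive t 1 f (p t * (p t)^-1 + F t * (u t * (p t)^-1)).
  by apply: is_derive1_mul.
have : 0 * (0 - x) <= f 0 - f x.
  apply: (@ge_slope _ f _ _ _ _ x0) => // [|t /andP[_ t0]].
    by apply: continuous_subspaceT => t; exact: is_derive1_continuous (df t).
  have /drift_lower_tail ut : u t <= 0 by exact: (drift_le0 law t0).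
  have -> : p t * (p t)^-1 + F t * (u t * (p t)^-1) =
            (p t - - u t * F t) / p t by ring.
  by rewrite divr_ge0 ?subr_ge0// ltW.
rewrite mul0r /f (density0 law) => h.
have c10 := norm_const_gt0.
have /andP[F0 F1] := F01 0.
have Fx : F x / p x * p x = F x by rewrite divfK// gt_eqF.
have hc : F 0 / c1 <= 1 / c1 by rewrite ler_pM2r ?invr_gt0.
have : F x / p x * p x <= 1 / c1 * p x.
  rewrite ler_pM2r//; lra.
rewrite Fx -(ler_pM2l c10) mulrA mulrCA divff ?gt_eqF// mulr1; lra.
Qed.

(** Since [p' = - u p], the sign of [u] makes [p] nondecreasing before 0 and nonincreasing after it,
    so the maximum is [p 0 = c1]. *)
Lemma density_le x : p x <= c1.
Proof.
rewrite -(density0 law).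
have [x0|/ltW x0] := leP 0 x.
  suff : 0 * (x - 0) <= - p x - - p 0 by lra.
  apply: (@ge_slope _ (fun t => - p t) (fun t => - - (u t * p t))) => //.
  - by apply: continuous_subspaceT => t; apply: continuousN; exact: p_cont.
  - by move=> t _; exact: is_derive1_opp.
  - move=> t /andP[t0 _]; rewrite opprK mulr_ge0 ?(ltW (p_gt0 t))//.
    exact: (drift_ge0 law t0).
suff : 0 * (0 - x) <= p 0 - p x by lra.
apply: (@ge_slope _ p (fun t => - (u t * p t))) => //.
- exact: continuous_subspaceT.
- move=> t /andP[_ t0]; rewrite -mulNr mulr_ge0 ?(ltW (p_gt0 t))// oppr_ge0.
  exact: (drift_le0 law t0).
Qed.

Lemma cdf_lipschitz x y : x <= y -> F y - F x <= c1 * (y - x).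
Proof.
move=> xy; apply: (@le_slope_except _ F p x) => // t _ _; exact: density_le.
Qed.

(* The bounded solution of f' - u f = 1_{]-oo, y]} - F y *)
Definition stein_sol y x := (Num.min (F x) (F y) - F x * F y) / p x.

Let fE_le y x : x <= y -> stein_sol y x = F x * (1 - F y) / p x.
Proof. by move=> /cdf_nd xy; rewrite /stein_sol min_l//; ring. Qed.

Let fE_ge y x : y <= x -> stein_sol y x = F y * (1 - F x) / p x.
Proof. by move=> /cdf_nd xy; rewrite /stein_sol min_r//; ring. Qed.

Let F_ge0 x : 0 <= F x. Proof. by case/andP: (F01 x). Qed.
Let F_le1 x : 0 <= 1 - F x. Proof. by rewrite subr_ge0; case/andP: (F01 x). Qed.

Lemma stein_sol_ge0 y x : 0 <= stein_sol y x.
Proof.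
have [xy|/ltW yx] := leP x y.
  by rewrite fE_le// divr_ge0 ?mulr_ge0// ltW.
by rewrite fE_ge// divr_ge0 ?mulr_ge0// ltW.
Qed.

(** Both tails are needed: [upper_tail_le] compares [1 - F] with [p] to the right of 0,
    [lower_tail_le] compares [F] with [p] to the left. Together they bound the solution by
    [1 / c1]. *)
Lemma stein_sol_le_tails y x :
  stein_sol y x * p x <= F x /\ stein_sol y x * p x <= 1 - F x.
Proof.
have p0 : p x != 0 by rewrite gt_eqF.
have Fx0 := F_ge0 x; have Fx1 := F_le1 x; have Fy0 := F_ge0 y; have Fy1 := F_le1 y.
by have [xy|/ltW yx] := leP x y; [rewrite fE_le// divfK//; have := cdf_nd xy|
  rewrite fE_ge// divfK//; have := cdf_nd yx]; split; nra.
Qed.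

Lemma stein_sol_le y x : stein_sol y x <= 1 / c1.
Proof.
have c10 := norm_const_gt0.
have [h1 h2] := stein_sol_le_tails y x.
rewrite ler_pdivlMr// -(ler_pM2r (p_gt0 x)) mul1r mulrAC.
have [x0|/ltW x0] := leP 0 x.
  by apply: le_trans (upper_tail_le x0); rewrite [leRHS]mulrC ler_pM2r.
by apply: le_trans (lower_tail_le x0); rewrite [leRHS]mulrC ler_pM2r.
Qed.

(** The sign of [u x] decides which tail bound applies. The interval has length 1 and is placed so
    that adding the indicator minus [F y] lands in [-1, 1]; the bound 1 on [|u f|] alone would not
    give [|f'| <= 1]. *)
Lemma drift_stein_sol_bound y x :
  - (1 - F y) <= u x * stein_sol y x <= F y.
Proof.
have p0 := p_gt0 x; have pn0 : p x != 0 by rewrite gt_eqF.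
have Fx0 := F_ge0 x; have Fx1 := F_le1 x; have Fy0 := F_ge0 y; have Fy1 := F_le1 y.
have f0 := stein_sol_ge0 y x.
have [ux|/ltW ux] := leP 0 (u x).
  have up := drift_upper_tail ux.
  apply/andP; split; first by have := mulr_ge0 ux f0; lra.
  rewrite -(ler_pM2r p0).
  have [xy|/ltW yx] := leP x y.
    rewrite -mulrA fE_le// divfK//; have Fxy := cdf_nd xy.
    apply: (@le_trans _ _ (F x * (u x * (1 - F x)))); last first.
      by apply: ler_pM => //; rewrite mulr_ge0.
    by rewrite mulrCA ler_wpM2l// ler_wpM2l//; lra.
  by rewrite -mulrA fE_ge// divfK// mulrCA ler_wpM2l.
have up := drift_lower_tail ux.
have nu : 0 <= - u x by rewrite oppr_ge0.
apply/andP; split; last by apply: le_trans Fy0; rewrite mulr_le0_ge0.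
rewrite lerNl -mulNr -(ler_pM2r p0).
have [xy|/ltW yx] := leP x y.
  by rewrite -mulrA fE_le// divfK// mulrA mulrC ler_wpM2l.
rewrite -mulrA fE_ge// divfK//; have Fxy := cdf_nd yx.
apply: (@le_trans _ _ ((1 - F x) * (- u x * F x))); last first.
  by apply: ler_pM => //; rewrite ?mulr_ge0//; lra.
by rewrite [leLHS]mulrA [leLHS]mulrC ler_wpM2l// ler_wpM2l.
Qed.

Lemma normr_drift_stein_sol y x : `|u x * stein_sol y x| <= 1.
Proof.
have Fy0 := F_ge0 y; have Fy1 := F_le1 y.
by have /andP[] := drift_stein_sol_bound y x; rewrite ler_norml; lra.
Qed.

(** The Stein equation solved for the derivative. At the kink [x = y] this is the left
    derivative. *)
Definition stein_sol_der y x := u x * stein_sol y x + (x <= y)%R%:R - F y.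

Lemma stein_sol_derive y x : x != y ->
  is_derive x 1 (stein_sol y) (stein_sol_der y x).
Proof.
have pn0 : p x != 0 by rewrite gt_eqF.
rewrite /stein_sol_der neq_lt => /orP[xy|yx].
  (* Off [y] the minimum is resolved on a whole neighbourhood, so the solution is locally a product
     of differentiable factors. *)
  apply: (@near_eq_is_derive _ _ _ (fun t => (F t * (1 - F y)) * (p t)^-1)).
    near=> t; rewrite fE_le//; apply/ltW.
    by near: t; exact: lt_nbhsl.
  have h : is_derive x 1 (fun t => F t * (1 - F y)) (p x * (1 - F y) + F x * 0).
    exact: is_derive1_mul.
  apply: (is_derive_eq (is_derive1_mul h (dV x))).
  by rewrite (ltW xy) fE_le ?ltW//=; field.
apply: (@near_eq_is_derive _ _ _ (fun t => (F y * (1 - F t)) * (p t)^-1)).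
  near=> t; rewrite fE_ge//; apply/ltW.
  by near: t; exact: lt_nbhsr.
have h : is_derive x 1 (fun t => F y * (1 - F t)) (F y * (0 - p x)).
  apply: is_derive1_scale.
  exact: is_derive1_add (is_derive_cst (1 : R) x 1) (is_derive1_opp (dF x)).
apply: (is_derive_eq (is_derive1_mul h (dV x))).
by rewrite leNgt yx fE_ge ?ltW//=; field.
Unshelve. all: by end_near. Qed.

Lemma continuous_stein_sol y : continuous (stein_sol y).
Proof.
move=> x; rewrite /stein_sol.
apply: cvgM; last by apply: cvgV; [rewrite gt_eqF|exact: p_cont].
apply: cvgB; last by apply: cvgM; [exact: F_cont|exact: cvg_cst].
by apply: continuous_min; [exact: F_cont|exact: cvg_cst].
Qed.

Lemma normr_stein_sol_der y x : `|stein_sol_der y x| <= 1.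
Proof.
have Fy0 := F_ge0 y; have Fy1 := F_le1 y.
have /andP[h1 h2] := drift_stein_sol_bound y x.
by rewrite /stein_sol_der ler_norml; case: (x <= y) => /=; lra.
Qed.

Lemma drift_stein_sol_derive y x : x != y ->
  is_derive x 1 (fun t => u t * stein_sol y t)
    (du x * stein_sol y x + u x * stein_sol_der y x).
Proof. by move=> xy; apply: is_derive1_mul => //; exact: stein_sol_derive. Qed.

Lemma continuous_drift_stein_sol y : continuous (fun t => u t * stein_sol y t).
Proof.
by move=> x; apply: cvgM; [exact: u_cont|exact: continuous_stein_sol].
Qed.

End stein_solution.
Arguments stein_sol {R} p F y x.
Arguments stein_sol_der {R} u p F y x.

(** * Local estimates from (H3) *)

Section pair_estimates.
Context {R : realType} {c1 c3 delta : R} {u du p F : R -> R}.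
Implicit Types w x y z m : R.
Hypothesis law : target_law c1 u du p F.
Hypothesis c3_ge0 : 0 <= c3.
Hypothesis du_bound : forall x b : R,
  b <= 1 / c1 -> `|u x| * b <= 1 -> `|du x| * b <= c1 * c3 / 3.
Hypotheses (delta_ge0 : 0 <= delta) (c1delta : c1 * delta <= 1)
  (c1c3delta : c1 * c3 * delta <= 1).

Let c1_gt0 := norm_const_gt0 law.
Let ddu := drift_derive law.
Let stein y x := stein_sol p F y x.

(** A bootstrap. By monotonicity a bound [M] on [|u|] at both ends holds on the whole interval; (H3)
    with [b = 1 / M] then bounds [|u'|] by [c1 c3 M / 3], so [u] varies by at most [M / 3]. Hence
    [M <= c1 + |u w| + M / 3], which bounds [M], and this bound is fed back into the variation of
    [u]. *)
Lemma drift_local_bound w x : `|x - w| <= delta ->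
  `|u x| <= 3 / 2 * `|u w| + c1 * c3 / 2.
Proof.
move=> xw.
pose M := Num.max c1 (Num.max `|u (w - delta)| `|u (w + delta)|).
have c1M : c1 <= M by rewrite /M le_max lexx.
have M_le B : c1 <= B -> `|u (w - delta)| <= B -> `|u (w + delta)| <= B -> M <= B.
  by move=> B1 B2 B3; rewrite /M !ge_max B1 B2.
have [Ml Mr] : `|u (w - delta)| <= M /\ `|u (w + delta)| <= M.
  by rewrite /M !le_max !lexx !orbT.
clearbody M.
have M0 : 0 < M by rewrite (lt_le_trans c1_gt0).
have uM t : `|t - w| <= delta -> `|u t| <= M.
  move=> tw.
  have [h1 h2] : w - delta <= t /\ t <= w + delta by move: tw; rewrite ler_norml; split; lra.
  have {}h1 := drift_nondecreasing law h1; have {}h2 := drift_nondecreasing law h2.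
  by move: Ml Mr; rewrite !ler_norml; lra.
have duM t : `|t - w| <= delta -> `|du t| <= c1 * c3 / 3 * M.
  move=> tw; rewrite -ler_pdivrMr//; apply: du_bound.
    by rewrite div1r lef_pV2 ?posrE.
  by rewrite ler_pdivrMr// mul1r; exact: uM.
have cM : c1 * c3 * delta * M <= M by rewrite ler_piMl// ltW.
have uw t : `|t - w| <= delta -> `|u t| <= `|u w| + c1 * c3 * delta * M / 3.
  move=> tw.
  have h : `|u t - u w| <= c1 * c3 / 3 * M * `|t - w|.
    apply: (@normr_slope_except _ u du t) => [z|z _|z ztw _].
    - exact: is_derive1_continuous (ddu z).
    - exact: ddu.
    - by apply: duM; exact: le_trans tw.
  have h' : c1 * c3 / 3 * M * `|t - w| <= c1 * c3 / 3 * M * delta.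
    by rewrite ler_wpM2l// mulr_ge0 ?(ltW M0)// divr_ge0// mulr_ge0// ltW.
  have := ler_normD (u t - u w) (u w); rewrite subrK; lra.
have MM : M <= 3 / 2 * (c1 + `|u w|).
  have u0 := normr_ge0 (u w); have c10 : 0 < c1 by [].
  have e1 : `|u (w - delta)| <= `|u w| + M / 3.
    apply: le_trans (uw _ _) _; last lra.
    by rewrite addrC addKr normrN ger0_norm.
  have e2 : `|u (w + delta)| <= `|u w| + M / 3.
    apply: le_trans (uw _ _) _; last lra.
    by rewrite addrC addKr ger0_norm.
  have : M <= c1 + `|u w| + M / 3 by apply: M_le; lra.
  lra.
apply: le_trans (uw _ xw) _.
have k0 : 0 <= c1 * c3 * delta by rewrite !mulr_ge0// ltW.
have h1 := ler_wpM2l k0 MM.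
have h2 : c1 * c3 * delta * `|u w| <= `|u w| by rewrite ler_piMl.
have h3 : (c1 * c3) * (c1 * delta) <= c1 * c3 by rewrite ler_piMr// mulr_ge0// ltW.
lra.
Qed.

(* [c1 c3 / 3] bounds [u' f]; the rest is the bound of [drift_local_bound] on
   [u], multiplied by [|f'| <= 1]. *)
Definition lip_const w := 5 / 6 * (c1 * c3) + 3 / 2 * `|u w|.

Let lip_const_ge0 w : 0 <= lip_const w.
Proof. by rewrite addr_ge0 ?mulr_ge0// ltW. Qed.

Lemma drift_stein_sol_lipschitz y w x : `|x - w| <= delta ->
  `|u x * stein y x - u w * stein y w| <= lip_const w * `|x - w|.
Proof.
move=> xw.
apply: (@normr_slope_except _ (fun t => u t * stein y t)
  (fun t => du t * stein y t + u t * stein_sol_der u p F y t) y).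
- exact: continuous_drift_stein_sol law y.
- by move=> t; exact: (drift_stein_sol_derive law).
move=> t tw _; apply: le_trans (ler_normD _ _) _.
have f0 : 0 <= stein y t by exact: stein_sol_ge0 law y t.
(* The value [f t] is itself an admissible [b] in [du_bound], as [f <= 1 / c1] and [|u f| <= 1]. *)
have h1 : `|du t * stein y t| <= c1 * c3 / 3.
  rewrite normrM (ger0_norm f0); apply: du_bound.
    exact: stein_sol_le law y t.
  by rewrite -(ger0_norm f0) -normrM; exact: normr_drift_stein_sol law y t.
have h2 : `|u t * stein_sol_der u p F y t| <= `|u t|.
  by rewrite normrM ler_piMr//; exact: normr_stein_sol_der law y t.
have h3 := drift_local_bound (le_trans tw xw).
rewrite /lip_const; lra.
Qed.

(** In [f' = u f + 1_{]-oo, y]} - F y], freezing [u f] at [w] costs [delta * lip_const w], which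
    becomes [delta ^+ 3 * lip_const w] after multiplication by the squared increment. The indicator
    is left between [m1] and [m2]. *)
Let pair_slopes y w w' (m1 m2 : R) : `|w - w'| <= delta ->
  (forall x, `|x - w| <= `|w' - w| -> m1 <= (x <= y)%R%:R <= m2) ->
  (w - w') ^+ 2 * (u w * stein y w + m1 - F y) - delta ^+ 3 * lip_const w
   <= (w - w') * (stein y w - stein y w')
   <= (w - w') ^+ 2 * (u w * stein y w + m2 - F y) + delta ^+ 3 * lip_const w.
Proof.
move=> ww' m12; rewrite distrC in ww'.
have L0 := lip_const_ge0 w.
have /andP[] : (u w * stein y w + m1 - F y - delta * lip_const w) * (w' - w) ^+ 2
    <= (w' - w) * (stein y w' - stein y w)
    <= (u w * stein y w + m2 - F y + delta * lip_const w) * (w' - w) ^+ 2.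
  apply: (@slope_except _ (stein y) (stein_sol_der u p F y) y).
  - exact: continuous_stein_sol law y.
  - by move=> x; exact: (stein_sol_derive law).
  move=> x xw _; rewrite /stein_sol_der -/(stein y x).
  have xw' := le_trans xw ww'.
  have := drift_stein_sol_lipschitz y xw'.
  have : lip_const w * `|x - w| <= lip_const w * delta by rewrite ler_wpM2l.
  have /andP[] := m12 _ xw.
  by rewrite ler_norml; lra.
have d2 : (w' - w) ^+ 2 <= delta ^+ 2.
  by rewrite -real_normK ?num_real// lerXn2r ?nnegrE.
have := ler_wpM2l (mulr_ge0 delta_ge0 L0) d2.
have -> : delta * lip_const w * delta ^+ 2 = delta ^+ 3 * lip_const w by ring.
have -> : (w' - w) * (stein y w' - stein y w) = (w - w') * (stein y w - stein y w') by ring.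
have -> : (w - w') ^+ 2 = (w' - w) ^+ 2 by ring.
set D := (w' - w) ^+ 2; lra.
Qed.

(** If [w <= z], every point within [delta] of [w] is at most [z + delta], so the indicator at the
    shifted test point dominates the one of [w <= z] along the whole segment. *)
Lemma stein_pair_ge z w w' : `|w - w'| <= delta ->
  (w - w') ^+ 2 * (u w * stein (z + delta) w + (w <= z)%R%:R - F (z + delta))
    - delta ^+ 3 * lip_const w
  <= (w - w') * (stein (z + delta) w - stein (z + delta) w').
Proof.
move=> ww'.
suff m12 x : `|x - w| <= `|w' - w| -> (w <= z)%R%:R <= ((x <= z + delta)%R%:R : R) <= 1.
  by have /andP[] := pair_slopes ww' m12.
move=> xw; rewrite lern1 leq_b1 andbT ler_nat.
have [wz|//] := leP w z; rewrite lt0b.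
have : `|x - w| <= delta by rewrite (le_trans xw)// distrC.
by rewrite ler_norml; lra.
Qed.

(** Shifting the other way, a point of the segment below [z - delta] forces [w <= z]. *)
Lemma stein_pair_le z w w' : `|w - w'| <= delta ->
  (w - w') * (stein (z - delta) w - stein (z - delta) w') <=
  (w - w') ^+ 2 * (u w * stein (z - delta) w + (w <= z)%R%:R - F (z - delta))
    + delta ^+ 3 * lip_const w.
Proof.
move=> ww'.
suff m12 x : `|x - w| <= `|w' - w| -> 0 <= ((x <= z - delta)%R%:R : R) <= (w <= z)%R%:R.
  by have /andP[] := pair_slopes ww' m12.
move=> xw; rewrite ler0n/= ler_nat.
have [xz|//] := leP x (z - delta); rewrite lt0b.
have : `|x - w| <= delta by rewrite (le_trans xw)// distrC.
by rewrite ler_norml; lra.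
Qed.

End pair_estimates.
Arguments lip_const {R} c1 c3 u w.

(** * The law of Y *)

Section target_law_construction.
Context {R : realType}.
Notation mu := (@lebesgue_measure R).
Implicit Types (g : R -> R) (x : R).

Lemma h3_min_ge (c0 c1 y b : R) : c0 != 0 -> b <= 1 / c1 -> `|c0 * y| * b <= 1 ->
  b <= h3_min c0 c1 y.
Proof.
rewrite /h3_min => c00 bc1 yb; case: ifPn => // y0; rewrite le_min bc1/=.
by rewrite ler_pdivlMr ?normr_gt0 ?mulf_neq0// mulrC.
Qed.

(** (H3) without the minimum: [b] stands for any number below both entries, such as a value of the
    Stein solution or the inverse of a bound on [|u|]. The weight [|x| + 3 / c1] is bounded below by
    [3 / c1]. *)
Lemma h3_derive_bound (c0 c1 c3 : R) g : 0 < c0 -> 0 < c1 ->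
  (forall x, h3_min c0 c1 (g x) * (`|x| + 3 / c1) * (c0 * `|derive1 g x|) <= c3) ->
  0 <= c3 /\ forall x b : R, b <= 1 / c1 -> `|c0 * g x| * b <= 1 ->
    `|c0 * derive1 g x| * b <= c1 * c3 / 3.
Proof.
move=> c00 c10 H3.
have c0n : c0 != 0 by rewrite gt_eqF.
have h0 x : 0 <= h3_min c0 c1 (g x).
  by apply: h3_min_ge; rewrite ?mulr0// ltW// divr_gt0.
have x0 x : 0 <= `|x| + 3 / c1 by rewrite addr_ge0// divr_ge0// ltW.
split.
  apply: le_trans (H3 0); rewrite !mulr_ge0//; exact: ltW.
move=> x b bc1 gb; rewrite normrM (gtr0_norm c00).
have bh := h3_min_ge c0n bc1 gb.
have d0 : 0 <= c0 * `|derive1 g x| by rewrite mulr_ge0// ltW.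
have h1 := ler_wpM2l d0 bh.
have h2 : h3_min c0 c1 (g x) * (c0 * `|derive1 g x|) * (3 / c1) <= c3.
  apply: le_trans (H3 x); rewrite mulrAC; apply: ler_wpM2r => //.
  by apply: ler_wpM2l => //; rewrite lerDr.
have h3 : h3_min c0 c1 (g x) * (c0 * `|derive1 g x|) <= c1 * c3 / 3.
  have -> : h3_min c0 c1 (g x) * (c0 * `|derive1 g x|) =
      h3_min c0 c1 (g x) * (c0 * `|derive1 g x|) * (3 / c1) * c1 / 3.
    by field; rewrite gt_eqF.
  by rewrite ler_pM2r// [leRHS]mulrC ler_pM2r.
by apply: le_trans h3; rewrite [leRHS]mulrC.
Qed.

(** With a base point [a] below both [x] and 0, both branches of [primG] become [H t - H 0] near
    [x], where [H] integrates from [a]; the sign of [t] no longer matters. *)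
Lemma primG_derive g x : continuous g -> is_derive x 1 (primG g) (g x).
Proof.
move=> cg.
have intg s t : mu.-integrable `[s, t] (EFin \o g).
  apply: continuous_compact_integrable; first exact: segment_compact.
  exact: continuous_subspaceT.
have intgo s t : mu.-integrable `]s, t] (EFin \o g).
  by apply: (integrableS _ _ _ (intg s t)) => //; apply: subset_itvr; rewrite bnd_simp.
have [a [ax a0]] : exists a : R, a < x /\ a < 0.
  exists (- `|x| - 1); have := ler_norm (- x); have := normr_ge0 x.
  by rewrite normrN; split; lra.
have [] := @continuous_FTC1_closed R g a x (x + 1) _ (intg _ _) ax (cg x).
  by rewrite ltrDl.
set H := (fun _ => _) => dH HE.
apply: (@near_eq_is_derive _ _ _ (fun t => H t + - H 0)).
  near=> t.
  have at_ : a < t by near: t; exact: lt_nbhsr.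
  rewrite /primG /H; case: ifPn => [t0|]; last rewrite -ltNge => t0.
    rewrite Rintegral_itvB ?bnd_simp ?(ltW a0)//.
    by rewrite Rintegral_itv_obnd_cbnd.
  rewrite -opprB; congr (- _).
  rewrite Rintegral_itvB ?bnd_simp ?(ltW at_) ?(ltW t0)//.
  by rewrite Rintegral_itv_obnd_cbnd.
rewrite -[g x]addr0 -HE derive1E.
exact: is_derive1_add (derivableP dH) (is_derive_cst (- H 0) x 1).
Unshelve. all: by end_near. Qed.

Lemma primG0 g : primG g 0 = 0.
Proof. by rewrite /primG lexx set_itv1 Rintegral_set1. Qed.

(** * Distribution functions and their limits at infinity *)

Section cdf_limits.
Context (d : measure_display) (T : measurableType d) (Q : probability T R).
Variable Y : T -> R.
Hypothesis mY : measurable_fun setT Y.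

Definition cdf_fun x := fine (Q (Y @^-1` `]-oo, x])).

Lemma cdf_funE x : (cdf_fun x)%:E = Q [set t | (Y t <= x)%R].
Proof.
rewrite /cdf_fun fineK; last first.
  by apply: fin_num_measure; rewrite -[_ @^-1` _]setTI; exact: mY.
by congr (Q _); apply/seteqP; split => t /=; rewrite in_itv.
Qed.

Lemma cdf_fun_bound x : 0 <= cdf_fun x <= 1.
Proof.
rewrite -!lee_fin cdf_funE measure_ge0/= probability_le1//.
rewrite (_ : [set _ | _] = setT `&` Y @^-1` `]-oo, x]); first exact: mY.
by rewrite setTI; apply/seteqP; split => t /=; rewrite in_itv.
Qed.

Let YR : {RV Q >-> R} := HB.pack Y (isMeasurableFun.Build _ _ _ _ Y mY).

Lemma cdf_fun_cvgy (e x : R) : 0 < e -> exists2 y : R, x <= y & 1 - cdf_fun y <= e.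
Proof.
move=> e0; have /fine_cvg/= := cvg_cdfy1 YR.
move=> /cvgrPdist_le/(_ _ e0) h.
have /filter_ex[y [xy hy]] : \forall y \near +oo%R, x <= y /\ `|1 - cdf_fun y| <= e.
  by near=> y; split; near: y; [exact/nbhs_pinfty_ge/num_real|exact: h].
by exists y => //; exact: le_trans (ler_norm _) hy.
Unshelve. all: by end_near. Qed.

Lemma cdf_fun_cvgNy (e x : R) : 0 < e -> exists2 y : R, y <= x & cdf_fun y <= e.
Proof.
move=> e0; have /fine_cvg/= := cvg_cdfNy0 YR.
move=> /cvgrPdist_le/(_ _ e0) h.
have /filter_ex[y [xy hy]] : \forall y \near -oo%R, y <= x /\ `|0 - cdf_fun y| <= e.
  by near=> y; split; near: y; [exact/nbhs_ninfty_le/num_real|exact: h].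
by exists y => //; move: hy; rewrite sub0r normrN; exact: le_trans (ler_norm _).
Unshelve. all: by end_near. Qed.

End cdf_limits.

Definition gibbs_density c0 c1 g x := c1 * expR (- (c0 * primG g x)).

Lemma gibbs_density_derive c0 c1 g x : continuous g ->
  is_derive x 1 (gibbs_density c0 c1 g) (- ((c0 * g x) * gibbs_density c0 c1 g x)).
Proof.
move=> cg.
have h := is_derive1_opp (is_derive1_scale c0 (primG_derive x cg)).
apply: (is_derive_eq (is_derive1_scale c1 (is_derive1_comp (is_derive_expR _) h))).
by rewrite /gibbs_density; ring.
Qed.

Lemma gibbs_target_law (d : measure_display) (T : measurableType d)
    (Q : probability T R) (Y : T -> R) (c0 : R) g
    (I := Rintegral mu setT (fun t => expR (- (c0 * primG g t)))) (c1 := 1 / I) :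
  measurable_fun setT Y -> 0 < c0 -> (forall x, derivable g x 1) ->
  mu.-integrable setT (fun t => (expR (- (c0 * primG g t)))%:E) ->
  (forall B : set R, measurable B ->
     Q (Y @^-1` B) = (\int[mu]_(t in B) (gibbs_density c0 c1 g t)%:E)%E) ->
  {homo g : x y / x <= y} -> (forall t, 0 < t -> 0 <= g t) ->
  (forall t, t <= 0 -> g t <= 0) ->
  target_law c1 (fun x => c0 * g x) (fun x => c0 * derive1 g x)
    (gibbs_density c0 c1 g) (cdf_fun Q Y).
Proof.
move=> mY c00 dg intp QY gh gge gle.
have cg : continuous g.
  by move=> x; apply: differentiable_continuous; apply/derivable1_diffP.
(* A vanishing normalising integral would give [c1 = 1 / 0 = 0] by convention; the law of [Y] would
   then have total mass 0 instead of 1. *)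
have c10 : 0 < c1.
  rewrite lt_def; apply/andP; split; last first.
    by rewrite divr_ge0//; apply: Rintegral_ge0 => t _; exact: expR_ge0.
  apply/eqP => c1E; have := QY setT measurableT.
  rewrite preimage_setT probability_setT integral0_eq.
    by move=> [] /eqP; rewrite oner_eq0.
  by move=> x _; rewrite /gibbs_density c1E mul0r.
have pint : mu.-integrable setT (EFin \o gibbs_density c0 c1 g).
  exact: (integrableZl measurableT c1 intp).
have dp x := gibbs_density_derive c0 c1 x cg.
have dF x : is_derive x 1 (cdf_fun Q Y) (gibbs_density c0 c1 g x).
  (* The point [x] is interior to ]-oo, x + 1], where the density is integrable and continuous at
     [x], so the fundamental theorem of calculus applies. *)
  have xx1 : x < x + 1 by rewrite ltrDl.
  have pintx : mu.-integrable `]-oo, x + 1] (EFin \o gibbs_density c0 c1 g).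
    exact: (integrableS measurableT _ _ pint).
  have /(_ _ (is_derive1_continuous (dp x)))[] := continuous_FTC1 xx1 pintx.
    by rewrite ltNyr.
  set H := (fun _ => _) => dH HE.
  have -> : cdf_fun Q Y = H by apply/funext => t; rewrite /H /cdf_fun QY.
  by rewrite -HE derive1E; exact: derivableP.
split => //.
- by move=> x y xy; rewrite ler_pM2l// gh.
- by move=> t t0; rewrite mulr_ge0 ?(ltW c00)// gge.
- by move=> t t0; rewrite mulr_ge0_le0 ?(ltW c00)// gle// ltW.
- move=> x; apply: is_derive1_scale; rewrite derive1E; exact: derivableP.
- by move=> x; rewrite mulr_gt0 ?expR_gt0.
- by rewrite /gibbs_density primG0 mulr0 oppr0 expR0 mulr1.
- exact: cdf_fun_bound.
- exact: cdf_fun_cvgy.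
- exact: cdf_fun_cvgNy.
Qed.

End target_law_construction.

(** * Conditional expectations and exchangeable pairs *)

Section bounded_factors.
Context (d : measure_display) (T : measurableType d) (R : realType)
  (P : probability T R).
Implicit Types f g : T -> R.

Lemma bounded_of_normr_le f (C : R) : (forall x, `|f x| <= C) ->
  [bounded f x | x in [set: T]].
Proof.
move=> fC; exists C; split; first exact: num_real.
by move=> M CM x _ /=; rewrite (le_trans (fC x))// ltW.
Qed.

Lemma integrable_of_bounded f (C : R) : measurable_fun setT f ->
  (forall x, `|f x| <= C) -> P.-integrable setT (EFin \o f).
Proof.
move=> mf fC; apply: measurable_bounded_integrable => //.
  by rewrite -ge0_fin_numE// fin_num_measure.
exact: bounded_of_normr_le fC.
Qed.

Lemma integrable_probability_cst (c : R) :
  P.-integrable setT (EFin \o (fun _ : T => c)).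
Proof. exact: (@integrable_of_bounded _ `|c|). Qed.

Lemma Rintegral_probability_cst (c : R) : Rintegral P setT (fun=> c) = c.
Proof.
rewrite Rintegral_cst// -[RHS]mulr1; congr (_ * _).
exact: (congr1 fine (probability_setT P)).
Qed.

Lemma integrable_mul_bounded f g (C : R) : P.-integrable setT (EFin \o f) ->
  measurable_fun setT g -> (forall x, `|g x| <= C) ->
  P.-integrable setT (EFin \o (fun x => f x * g x)).
Proof.
move=> intf mg gC.
exact: (integrableMl measurableT intf mg (bounded_of_normr_le gC)).
Qed.

Lemma normr_Rintegral_mul_le f g (C : R) : P.-integrable setT (EFin \o f) ->
  measurable_fun setT g -> (forall x, `|g x| <= C) ->
  `|Rintegral P setT (fun x => f x * g x)| <= C * Rintegral P setT (fun x => `|f x|).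
Proof.
move=> intf mg gC.
have intfg := integrable_mul_bounded intf mg gC.
apply: le_trans (le_normr_Rintegral _ intfg) _ => //.
have intnf : P.-integrable setT (EFin \o (fun x => `|f x|)) by exact: integrable_abse intf.
rewrite -RintegralZl//; apply: le_Rintegral => //.
- exact: integrable_abse intfg.
- exact: (integrableZl measurableT C intnf).
- by move=> x _; rewrite normrM mulrC ler_wpM2r.
Qed.

End bounded_factors.

Section conditional_expectation.
Context (d : measure_display) (T : measurableType d) (R : realType)
  (P : probability T R).
Variables (W D : T -> R).
Hypotheses (mW : measurable_fun setT W) (intD : P.-integrable setT (EFin \o D)).
Hypothesis D0 : forall B : set R, measurable B ->
  Rintegral P (W @^-1` B) D = 0.

(** First stage of the usual extension from indicators to bounded functions: an indicator of [W]
    restricts the integral of [D] to a preimage, where it vanishes. *)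
Let null_indic (a : R) (B : set R) : measurable B ->
  Rintegral P setT (fun w => D w * (a * \1_B (W w))) = 0.
Proof.
move=> mB.
have mWB : measurable (W @^-1` B) by rewrite -[_ @^-1` _]setTI; exact: mW.
have intB : P.-integrable setT (EFin \o (D \_ (W @^-1` B))).
  rewrite -restrict_EFin; apply/integrable_restrict => //; rewrite setTI.
  exact: (integrableS measurableT _ _ intD).
transitivity (a * Rintegral P (W @^-1` B) D); last by rewrite D0// mulr0.
rewrite [in RHS]Rintegral_mkcond -RintegralZl//.
apply: eq_Rintegral => w _; rewrite /patch indicE.
have -> : (W w \in B) = (w \in W @^-1` B) by apply/idP/idP; rewrite !inE.
by case: ifPn => /= _; rewrite ?mulr1 ?mulr0// mulrC.
Qed.

Let null_sum (B : R -> set R) (s : seq R) : (forall a, measurable (B a)) ->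
  Rintegral P setT (fun w => D w * \sum_(a <- s) a * \1_(B a) (W w)) = 0.
Proof.
move=> mB.
have mi a : measurable_fun setT (fun w => a * \1_(B a) (W w)).
  by apply: measurable_funM => //; apply: measurableT_comp => //; exact: measurable_indic.
have intB a : P.-integrable setT (EFin \o (fun w => D w * (a * \1_(B a) (W w)))).
  apply: (@integrable_mul_bounded _ _ _ P _ _ `|a|) => // w.
  by rewrite normrM ler_piMr// indicE; case: (_ \in _); rewrite ?normr1 ?normr0.
(* Integrability is carried through the induction along with the value, because additivity of the
   integral requires it. *)
suff : P.-integrable setT (EFin \o (fun w => D w * \sum_(a <- s) a * \1_(B a) (W w))) /\
  Rintegral P setT (fun w => D w * \sum_(a <- s) a * \1_(B a) (W w)) = 0 by case.
elim: s => [|a s [ints IH]].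
  have E0 : (fun w => D w * \sum_(a <- [::]) a * \1_(B a) (W w)) = fun=> 0.
    by apply/funext => w; rewrite big_nil mulr0.
  rewrite E0; split; first exact: integrable0.
  by rewrite Rintegral_cst// mul0r.
have -> : (fun w => D w * \sum_(a0 <- a :: s) a0 * \1_(B a0) (W w)) =
  fun w => D w * (a * \1_(B a) (W w)) + D w * \sum_(a0 <- s) a0 * \1_(B a0) (W w).
  by apply/funext => w; rewrite big_cons mulrDr.
split; first exact: (integrableD measurableT (intB a) ints).
by rewrite RintegralD// null_indic// IH addr0.
Qed.

Import HBNNSimple.

Let null_nnsfun (f : {nnsfun R >-> R}) :
  Rintegral P setT (fun w => D w * f (W w)) = 0.
Proof.
under eq_Rintegral do rewrite fimfunE fsbig_finite//=.
exact: null_sum.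
Qed.

Lemma null_bounded (phi : R -> R) (C : R) : measurable_fun setT phi ->
  (forall x, `|phi x| <= C) -> Rintegral P setT (fun w => D w * phi (W w)) = 0.
Proof.
move=> mphi phiC.
(* The shift by [C] makes the function nonnegative, hence an increasing limit of simple functions;
   it is undone at the end, since [D] has integral 0. *)
pose psi x := phi x + C.
have psi0 x : 0 <= psi x by have := phiC x; rewrite ler_norml /psi; lra.
have psiC x : `|psi x| <= 2 * C.
  by rewrite ger0_norm//; have := phiC x; rewrite ler_norml /psi; lra.
have mpsi : measurable_fun setT psi by exact: measurable_funD.
have mepsi : measurable_fun setT (EFin \o psi) by exact/measurable_EFinP.
pose f n := nnsfun_approx measurableT mepsi n.
have f_cvg x : (f n x)%:E @[n --> \oo] --> (psi x)%:E.
  by apply: (@cvg_nnsfun_approx _ _ _ _ measurableT _ mepsi) => // y _; rewrite lee_fin.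
(* The approximations increase to [psi] and inherit its bound, so [2 * C * |D|] dominates all
   products. *)
have f_le n x : `|f n x| <= 2 * C.
  rewrite ger0_norm//.
  apply: le_trans (psiC x); rewrite (ger0_norm (psi0 x)).
  have cvgf : f n x @[n --> \oo] --> psi x by exact: (fine_cvg (f_cvg x)).
  have nd : nondecreasing_seq (fun n => f n x).
    by move=> m k mk; exact/lefP/nd_nnsfun_approx.
  rewrite -(cvg_lim (@Rhausdorff R) cvgf).
  by apply: (nondecreasing_cvgn_le nd); apply/cvg_ex; exists (psi x).
have intDf n : P.-integrable setT (EFin \o (fun w => D w * f n (W w))).
  by apply: (integrable_mul_bounded intD (measurableT_comp _ mW)) => // w; exact: f_le.
have intDpsi : P.-integrable setT (EFin \o (fun w => D w * psi (W w))).
  by apply: (integrable_mul_bounded intD (measurableT_comp mpsi mW)) => // w; exact: psiC.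
have psi_null : Rintegral P setT (fun w => D w * psi (W w)) = 0.
  have [] := @dominated_convergence _ _ _ P setT measurableT
    (fun n w => (D w * f n (W w))%:E) (fun w => (D w * psi (W w))%:E)
    (fun w => (2 * C * `|D w|)%:E).
  - by move=> n; exact: (measurable_int P (intDf n)).
  - exact: (measurable_int P intDpsi).
  - apply/aeW => w _; under eq_fun do rewrite EFinM.
    by rewrite EFinM; apply: cvgeZl => //; exact: f_cvg.
  - exact: (integrableZl measurableT (2 * C) (integrable_abse intD)).
  - apply/aeW => w n _; rewrite abse_EFin lee_fin normrM mulrC.
    by rewrite ler_wpM2r.
  move=> _ _ lim_int; rewrite /Rintegral.
  have lim0 : (\int[P]_w (D w * f n (W w))%:E)%E @[n --> \oo] --> (0%:E : \bar R).
    rewrite (_ : (fun n => _) = fun=> 0%:E); first exact: cvg_cst.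
    apply/funext => n; rewrite -(null_nnsfun (f n)) /Rintegral fineK//.
    exact: (integrable_fin_num measurableT (intDf n)).
  by rewrite (cvg_unique (@ereal_hausdorff R) lim_int lim0).
have intDC : P.-integrable setT (EFin \o (fun w => D w * C)).
  by apply: (@integrable_mul_bounded _ _ _ _ _ _ `|C|).
transitivity (Rintegral P setT (fun w => D w * psi (W w)) -
  Rintegral P setT (fun w => D w * C)).
  rewrite -RintegralB//; apply: eq_Rintegral => w _; rewrite /psi; ring.
by rewrite psi_null RintegralZr// -(preimage_setT W) D0// mul0r subrr.
Qed.

End conditional_expectation.

(** The difference [X - h(W)] integrates to 0 over every preimage under [W], so [null_bounded]
    applies to it. *)
Lemma cond_exp_bounded (d : measure_display) (T : measurableType d) (R : realType)
    (P : probability T R) (W X : T -> R) (h phi : R -> R) (C : R) :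
  measurable_fun setT W -> is_cond_exp P W X h -> measurable_fun setT phi ->
  (forall x, `|phi x| <= C) ->
  Rintegral P setT (fun w => X w * phi (W w)) =
  Rintegral P setT (fun w => h (W w) * phi (W w)).
Proof.
move=> mW [mh [intX [inth Xh]]] mphi phiC.
have intD : P.-integrable setT (EFin \o (fun w => X w - h (W w))).
  exact: (integrableB measurableT intX inth).
have mphiW := measurableT_comp mphi mW.
have := @null_bounded _ _ _ P W (fun w => X w - h (W w)) mW intD _ phi C mphi phiC.
have -> : (fun w => (X w - h (W w)) * phi (W w)) =
    (fun w => X w * phi (W w) - h (W w) * phi (W w)).
  by apply/funext => w; rewrite mulrBl.
rewrite RintegralB//; last 2 first.
- by apply: (integrable_mul_bounded intX mphiW) => w; exact: phiC.
- by apply: (integrable_mul_bounded inth mphiW) => w; exact: phiC.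
move=> /(_ _)/eqP; rewrite subr_eq0 => H; apply/eqP/H => B mB.
have mWB : measurable (W @^-1` B) by rewrite -[_ @^-1` _]setTI; exact: mW.
rewrite RintegralB//; last 2 first.
- exact: (integrableS measurableT _ _ intX).
- exact: (integrableS measurableT _ _ inth).
by rewrite /Rintegral Xh// subrr.
Qed.

Section exchangeable_pairs.
Context (d : measure_display) (T : measurableType d) (R : realType)
  (P : probability T R).
Variables (W W' : T -> R).
Hypotheses (mW : measurable_fun setT W) (mW' : measurable_fun setT W').
Hypothesis exch : exchangeable P W W'.

(** Both sides are integrals of [phi] against image measures on the plane, and exchangeability says
    that these measures agree. *)
Lemma exchangeable_Rintegral (phi : R * R -> R) (C : R) :
  measurable_fun setT phi ->
  (forall w, `|phi (W w, W' w)| <= C) -> (forall w, `|phi (W' w, W w)| <= C) ->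
  Rintegral P setT (fun w => phi (W w, W' w)) =
  Rintegral P setT (fun w => phi (W' w, W w)).
Proof.
move=> mphi phiC phiC'.
have m1 : measurable_fun setT (fun w => (W w, W' w)) by exact: measurable_fun_pair.
have m2 : measurable_fun setT (fun w => (W' w, W w)) by exact: measurable_fun_pair.
have mephi : measurable_fun setT (EFin \o phi) by exact/measurable_EFinP.
rewrite /Rintegral; congr fine.
have int1 := integrable_of_bounded P (measurableT_comp mphi m1) phiC.
have int2 := integrable_of_bounded P (measurableT_comp mphi m2) phiC'.
have := @integral_pushforward _ _ _ _ _ _ m1 P setT _ mephi int1 measurableT.
have := @integral_pushforward _ _ _ _ _ _ m2 P setT _ mephi int2 measurableT.
rewrite !preimage_setT => <- <-.
by apply: eq_measure_integral => A mA _; exact: exch.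
Qed.

(** Swapping the pair turns [E[(W - W') f(W)]] into [- E[(W - W') f(W')]]; the two expressions are
    added. *)
Lemma exchangeable_antisym (delta C : R) (f : R -> R) :
  (forall w, `|W w - W' w| <= delta) -> measurable_fun setT f ->
  (forall x, `|f x| <= C) ->
  2 * Rintegral P setT (fun w => (W w - W' w) * f (W w)) =
  Rintegral P setT (fun w => (W w - W' w) * (f (W w) - f (W' w))).
Proof.
move=> dWW mf fC.
pose phi (t : R * R) := (t.1 - t.2) * f t.1.
have mphi : measurable_fun setT phi.
  apply: measurable_funM; first exact: measurable_funB.
  exact: measurableT_comp.
have b1 w : `|phi (W w, W' w)| <= delta * C by rewrite /phi/= normrM ler_pM.
have b2 w : `|phi (W' w, W w)| <= delta * C.
  by rewrite /phi/= normrM distrC ler_pM.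
have m1 : measurable_fun setT (fun w => phi (W w, W' w)).
  exact: measurableT_comp mphi (measurable_fun_pair mW mW').
have m2 : measurable_fun setT (fun w => phi (W' w, W w)).
  exact: measurableT_comp mphi (measurable_fun_pair mW' mW).
rewrite mulrDl mul1r {2}(exchangeable_Rintegral mphi b1 b2) -RintegralD//; last 2 first.
- exact: integrable_of_bounded m1 b1.
- exact: integrable_of_bounded m2 b2.
by apply: eq_Rintegral => w _; rewrite /phi/=; ring.
Qed.

End exchangeable_pairs.

(** * The smoothed discrepancy *)

Section smoothed_discrepancy.
Context (d : measure_display) (T : measurableType d) (R : realType)
  (P : probability T R).
Variables (W W' : T -> R) (g r k f L : R -> R) (c0 c1 delta z y0 s : R).
Hypotheses (mW : measurable_fun setT W) (mW' : measurable_fun setT W').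
Hypothesis exch : exchangeable P W W'.
Hypothesis condW : is_cond_exp P W (fun w => W w - W' w) (fun x => g x + r x).
Hypothesis condW2 : is_cond_exp P W (fun w => (W w - W' w) ^+ 2) k.
Hypothesis c0_gt0 : 0 < c0.
Hypothesis WW'_le : forall w, `|W w - W' w| <= delta.
Hypothesis mg : measurable_fun setT g.
Hypothesis intg : P.-integrable setT (EFin \o (g \o W)).
Hypotheses (mf : measurable_fun setT f) (f_le : forall x, `|f x| <= 1 / c1).
Hypothesis gf_le : forall x, `|c0 * g x * f x| <= 1.
Hypothesis y01 : 0 <= y0 <= 1.
Hypothesis intL : P.-integrable setT (EFin \o (L \o W)).
Hypothesis s_sign : s = 1 \/ s = -1.

(** The Stein derivative with its indicator moved to [z], while [f] and [y0 = F y] belong to the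
    shifted test point [y]. *)
Let A x := c0 * g x * f x + (x <= z)%R%:R - y0.

Hypothesis pair_bound : forall w,
  s * ((W w - W' w) ^+ 2 * A (W w)) - delta ^+ 3 * L (W w) <=
  s * ((W w - W' w) * (f (W w) - f (W' w))).

Let E (X : T -> R) := Rintegral P setT X.

Let m_indic : measurable_fun setT (fun x : R => ((x <= z)%R%:R : R)).
Proof.
rewrite (_ : (fun x : R => _) = \1_(`]-oo, z]%classic)); first exact: measurable_indic.
by apply/funext => x; rewrite indicE mem_setE in_itv.
Qed.

Let mA : measurable_fun setT A.
Proof.
apply: measurable_funB => //; apply: measurable_funD => //.
by apply: measurable_funM => //; exact: measurable_funM.
Qed.

Let A_le x : `|A x| <= 2.
Proof.
have /andP[? ?] := y01.
by have := gf_le x; rewrite /A !ler_norml; case: (x <= z) => /=; lra.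
Qed.

Let intr : P.-integrable setT (EFin \o (r \o W)).
Proof.
have [_ [_ [h _]]] := condW.
have := integrableB measurableT h intg; congr (integrable P setT _).
by apply/funext => w /=; rewrite -EFinB; congr EFin; ring.
Qed.

Let intk : P.-integrable setT (EFin \o (k \o W)).
Proof. by have [_ [_ [h _]]] := condW2. Qed.

Let E_indic : E (fun w => (W w <= z)%R%:R) = cdf_fun P W z.
Proof.
have mWz : measurable (W @^-1` `]-oo, z]) by rewrite -[_ @^-1` _]setTI; exact: mW.
rewrite /E /Rintegral /cdf_fun; congr fine.
rewrite -[W @^-1` _]setIT -(integral_indic P measurableT mWz).
apply: eq_integral => w _; congr (_%:E); rewrite indicE.
by congr (nat_of_bool _)%:R; apply/idP/idP; rewrite inE/= in_itv.
Qed.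

(** With [u = c0 g], [P(W <= z) - y0 = E[A(W)] - E[u f(W)]], and [E[A(W)]] splits as
    [E[(1 - c0 k / 2) A(W)] + (c0 / 2) E[k A(W)]]. The pair bound compares the last term with [c0
    E[(g + r) f(W)]], whose drift part cancels [E[u f(W)]]. What remains is estimated by [|A| <= 2]
    and [|f| <= 1 / c1]. The sign [s] treats upper and lower bounds at once. *)
Lemma smoothed_discrepancy :
  s * (cdf_fun P W z - y0) <=
  2 * E (fun w => `|1 - c0 / 2 * k (W w)|) + c0 / c1 * E (fun w => `|r (W w)|)
  + c0 / 2 * (delta ^+ 3 * E (L \o W)).
Proof.
have mfW : measurable_fun setT (f \o W) by exact: measurableT_comp.
have mfW' : measurable_fun setT (f \o W') by exact: measurableT_comp.
have mAW : measurable_fun setT (A \o W) by exact: measurableT_comp.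
have AW_le w : `|(A \o W) w| <= 2 by exact: A_le.
have fW_le w : `|(f \o W) w| <= 1 / c1 by exact: f_le.
have mh : measurable_fun setT (fun x => c0 * g x * f x).
  by apply: measurable_funM => //; exact: measurable_funM.
have e1 := exchangeable_antisym mW mW' exch WW'_le mf f_le.
have e2 := cond_exp_bounded mW condW mf f_le.
have e3 := cond_exp_bounded mW condW2 mA A_le.
have int_A : P.-integrable setT (EFin \o (A \o W)) by exact: integrable_of_bounded mAW AW_le.
have int_kA : P.-integrable setT (EFin \o (fun w => k (W w) * A (W w))).
  exact: integrable_mul_bounded intk mAW AW_le.
have int_D2A : P.-integrable setT (EFin \o (fun w => (W w - W' w) ^+ 2 * A (W w))).
  have [_ [h _]] := condW2; exact: integrable_mul_bounded h mAW AW_le.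
have int_Df : P.-integrable setT (EFin \o (fun w => (W w - W' w) * (f (W w) - f (W' w)))).
  have [_ [h _]] := condW.
  apply: (@integrable_mul_bounded _ _ _ P _ _ (1 / c1 + 1 / c1) h).
    exact: measurable_funB.
  by move=> w; apply: le_trans (ler_normB _ _) _; exact: lerD.
have int_h : P.-integrable setT (EFin \o (fun w => c0 * g (W w) * f (W w))).
  apply: (@integrable_of_bounded _ _ _ P _ 1); last by move=> w; exact: gf_le.
  exact: measurableT_comp mh mW.
have int_rf : P.-integrable setT (EFin \o (fun w => r (W w) * f (W w))).
  exact: integrable_mul_bounded intr mfW fW_le.
have int_i : P.-integrable setT (EFin \o (fun w => ((W w <= z)%R%:R : R))).
  apply: (@integrable_of_bounded _ _ _ P _ 1).
    exact: measurableT_comp m_indic mW.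
  by move=> w; case: (W w <= z); rewrite ?normr1 ?normr0.
have int_1 := integrable_probability_cst P.
have E_cst c : E (fun=> c) = c by exact: Rintegral_probability_cst.
have int_ck : P.-integrable setT (EFin \o (fun w => c0 / 2 * k (W w))).
  exact: (integrableZl measurableT (c0 / 2) intk).
have int_1k : P.-integrable setT (EFin \o (fun w => 1 - c0 / 2 * k (W w))).
  exact: (integrableB measurableT (int_1 1) int_ck).
have e4 : s * E (fun w => (W w - W' w) ^+ 2 * A (W w)) - delta ^+ 3 * E (L \o W)
    <= s * E (fun w => (W w - W' w) * (f (W w) - f (W' w))).
  have i1 := integrableZl measurableT s int_D2A.
  have i2 := integrableZl measurableT (delta ^+ 3) intL.
  rewrite /E -!RintegralZl// -RintegralB//; apply: le_Rintegral => //.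
  - exact: (integrableB measurableT i1 i2).
  - exact: (integrableZl measurableT s int_Df).
have e5 : c0 * E (fun w => (g (W w) + r (W w)) * f (W w)) =
    E (fun w => c0 * g (W w) * f (W w)) + c0 * E (fun w => r (W w) * f (W w)).
  have int_gf := integrable_mul_bounded intg mfW fW_le.
  have -> : (fun w => (g (W w) + r (W w)) * f (W w)) =
      (fun w => g (W w) * f (W w) + r (W w) * f (W w)).
    by apply/funext => w; rewrite mulrDl.
  rewrite {1}/E RintegralD// mulrDr; congr (_ + _).
  by rewrite /E -RintegralZl//; apply: eq_Rintegral => w _; rewrite mulrA.
have e6 : E (A \o W) = E (fun w => c0 * g (W w) * f (W w))
    + cdf_fun P W z - y0.
  rewrite -E_indic -[in RHS](E_cst y0) /E -RintegralD// -RintegralB//.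
  exact: (integrableD measurableT int_h int_i).
have e7 : E (fun w => (1 - c0 / 2 * k (W w)) * A (W w)) =
    E (A \o W) - c0 / 2 * E (fun w => k (W w) * A (W w)).
  rewrite /E -RintegralZl// -RintegralB//; last first.
    exact: (integrableZl measurableT (c0 / 2) int_kA).
  by apply: eq_Rintegral => w _ /=; ring.
have b1 : `|E (fun w => (1 - c0 / 2 * k (W w)) * A (W w))| <=
    2 * E (fun w => `|1 - c0 / 2 * k (W w)|).
  exact: normr_Rintegral_mul_le int_1k mAW AW_le.
have b2 : c0 * `|E (fun w => r (W w) * f (W w))| <= c0 / c1 * E (fun w => `|r (W w)|).
  rewrite -mulrA ler_pM2l// -[c1^-1]mul1r.
  exact: normr_Rintegral_mul_le intr mfW fW_le.
have n1 := ler_norm (E (fun w => (1 - c0 / 2 * k (W w)) * A (W w))).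
have n2 := ler_norm (- E (fun w => (1 - c0 / 2 * k (W w)) * A (W w))).
have n3 : c0 * E (fun w => r (W w) * f (W w)) <= c0 * `|E (fun w => r (W w) * f (W w))|.
  by rewrite ler_pM2l// ler_norm.
have n4 : c0 * - E (fun w => r (W w) * f (W w)) <= c0 * `|E (fun w => r (W w) * f (W w))|.
  by rewrite ler_pM2l// -normrN ler_norm.
(* The factor [c0 / 2] offsets the 2 from exchangeability and produces the drift [c0 g]. *)
have e4' := ler_wpM2l (ltW (divr_gt0 c0_gt0 (ltr0n R 2))) e4.
rewrite normrN in n2; rewrite -/(E _) -/(E _) in e1.
rewrite -/(E _) -/(E _) in e2; rewrite -/(E _) -/(E _) in e3.
have e2' : E (fun w => (W w - W' w) * (f (W w) - f (W' w))) =
    2 * E (fun w => (g (W w) + r (W w)) * f (W w)) by rewrite -e1 e2.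
rewrite e2' e3 in e4'.
have [sE|sE] := s_sign; rewrite sE in e4' *; lra.
Qed.

End smoothed_discrepancy.

(** * Degenerate cases and assembly of the two one-sided bounds *)

Unset Implicit Arguments.

Theorem theorem1p2 (R : realType)
  (d : measure_display) (T : measurableType d) (P : probability T R)
  (W W' : T -> R) (g r k : R -> R) (c0 c3 delta : R)
  (d' : measure_display) (T' : measurableType d') (Q : probability T' R)
  (Y : T' -> R) :
  measurable_fun setT W -> measurable_fun setT W' ->
  exchangeable P W W' ->
  (forall x, derivable g x 1) ->
  measurable_fun setT r ->
  is_cond_exp P W (fun w => W w - W' w) (fun x => g x + r x) ->
  is_cond_exp P W (fun w => (W w - W' w) ^+ 2) k ->
  0 < c0 ->
  lebesgue_measure.-integrable setT
    (fun t => (expR (- (c0 * primG g t)))%:E) ->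
  let c1 := 1 / Rintegral lebesgue_measure setT
                  (fun t => expR (- (c0 * primG g t))) in
  measurable_fun setT Y ->
  (forall B : set R, measurable B ->
     Q (Y @^-1` B) = (\int[lebesgue_measure]_(t in B)
                        (c1 * expR (- (c0 * primG g t)))%:E)%E) ->
  (* (H1) *)
  {homo g : x y / x <= y} ->
  (forall t, 0 < t -> 0 <= g t) ->
  (forall t, t <= 0 -> g t <= 0) ->
  (* (H3) *)
  (forall x, h3_min c0 c1 (g x) * (`|x| + 3 / c1) * (c0 * `|derive1 g x|) <= c3) ->
  (forall w, `|W w - W' w| <= delta) ->
  forall z : R,
  (`| P [set w | (W w <= z)%R] - Q [set t | (Y t <= z)%R] |
   <= 3%:E * \int[P]_w (`|1 - c0 / 2 * k (W w)|)%:E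
      + (c1 * Num.max 1 c3 * delta)%:E
      + (2 * c0 / c1)%:E * \int[P]_w (`|r (W w)|)%:E
      + (delta ^+ 3 * c0)%:E *
          ((2 + c3 / 2)%:E * \int[P]_w (`|c0 * g (W w)|)%:E
           + (c1 * c3 / 2)%:E))%E.
Proof.
move=> mW mW' exch dg mr condW condW2 c0_gt0 intp c1 mY QY gh gge gle H3 dWW z.
have law := gibbs_target_law mY c0_gt0 dg intp QY gh gge gle.
rewrite -/c1 in law; clearbody c1.
have c1_gt0 := norm_const_gt0 law.
have [c3_ge0 du_bound] := h3_derive_bound c0_gt0 c1_gt0 H3.
have cg : continuous g.
  by move=> x; apply: differentiable_continuous; apply/derivable1_diffP.
have mg : measurable_fun setT g by exact: continuous_measurable_fun.
have PT : P setT = 1%E by exact: probability_setT.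
(* A space of total mass 1 has a point, and [delta] bounds an absolute value there. *)
have delta_ge0 : 0 <= delta.
  have [w _] : [set: T] !=set0.
    apply/set0P/eqP => T0; move: PT; rewrite T0 measure0 => -[] /eqP.
    by rewrite eq_sym oner_eq0.
  exact: le_trans (dWW w).
rewrite -!cdf_funE// -EFinB abse_EFin.
set F := cdf_fun Q Y in law *; set p := cdf_fun P W z.
have p01 : 0 <= p <= 1 by exact: cdf_fun_bound.
have F01 := cdf_bound law z.
have pF1 : `|p - F z| <= 1.
  by move: p01 F01 => /andP[? ?] /andP[? ?]; rewrite ler_norml; lra.
set I1 := (\int[P]_w (`|1 - c0 / 2 * k (W w)|)%:E)%E.
set I2 := (\int[P]_w (`|r (W w)|)%:E)%E.
set I3 := (\int[P]_w (`|c0 * g (W w)|)%:E)%E.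
have I1_ge0 : (0 <= I1)%E by apply: integral_ge0 => w _; rewrite lee_fin.
have I2_ge0 : (0 <= I2)%E by apply: integral_ge0 => w _; rewrite lee_fin.
have I3_ge0 : (0 <= I3)%E by apply: integral_ge0 => w _; rewrite lee_fin.
have d3_ge0 : 0 <= delta ^+ 3 * c0 by rewrite mulr_ge0 ?exprn_ge0// ltW.
have K_ge : c1 * delta <= c1 * Num.max 1 c3 * delta.
  by rewrite ler_wpM2r// ler_peMr ?(ltW c1_gt0)// le_max lexx.
have K_ge3 : c1 * c3 * delta <= c1 * Num.max 1 c3 * delta.
  by rewrite ler_wpM2r// ler_wpM2l ?(ltW c1_gt0)// le_max lexx orbT.
have c1d_ge0 : 0 <= c1 * delta by rewrite mulr_ge0// ltW.
have t1_ge0 : (0 <= 3%:E * I1)%E by rewrite mule_ge0.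
have t3_ge0 : (0 <= (2 * c0 / c1)%:E * I2)%E.
  by apply: mule_ge0 => //; rewrite lee_fin divr_ge0 ?mulr_ge0 ?(ltW c0_gt0) ?(ltW c1_gt0)//.
have t4'_ge0 : (0 <= (2 + c3 / 2)%:E * I3 + (c1 * c3 / 2)%:E)%E.
  apply: adde_ge0; last by rewrite lee_fin divr_ge0// mulr_ge0// ltW.
  by apply: mule_ge0 => //; rewrite lee_fin addr_ge0// divr_ge0.
have t4_ge0 : (0 <= (delta ^+ 3 * c0)%:E * ((2 + c3 / 2)%:E * I3 + (c1 * c3 / 2)%:E))%E.
  exact: mule_ge0.
have intk : P.-integrable setT (EFin \o (k \o W)) by have [_ [_ [h _]]] := condW2.
have int1 := integrable_probability_cst P (1 : R).
have int_1k : P.-integrable setT (EFin \o (fun w => 1 - c0 / 2 * k (W w))).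
  exact: (integrableB measurableT int1 (integrableZl measurableT (c0 / 2) intk)).
have I1E : I1 = (Rintegral P setT (fun w => `|1 - c0 / 2 * k (W w)|))%:E.
  rewrite /Rintegral fineK//.
  exact: (integrable_fin_num measurableT (integrable_abse int_1k)).
(* Two probabilities differ by at most 1. In the other case [c1 * delta] and [c1 * c3 * delta] are
   below 1, as the local estimates require. *)
have [K1|K1] := leP 1 (c1 * Num.max 1 c3 * delta).
  apply: (@le_trans _ _ (c1 * Num.max 1 c3 * delta)%:E).
    by rewrite lee_fin (le_trans pF1).
  by rewrite -addeA addeAC leeDr// !adde_ge0.
have [d0|d_neq0] := eqVneq delta 0.
  (* Here [W = W'], so E(Delta^2 | W) = 0 and already the first term is at least 1. *)
  have E1 : 1 <= Rintegral P setT (fun w => `|1 - c0 / 2 * k (W w)|).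
    apply: le_trans (le_normr_Rintegral measurableT int_1k).
    have k0 : Rintegral P setT (k \o W) = 0.
      have [_ [_ [_ /(_ setT measurableT)]]] := condW2.
      rewrite preimage_setT /Rintegral => <-; rewrite integral0_eq// => w _.
      have := dWW w; rewrite d0 normr_le0 => /eqP ->.
      by rewrite expr0n.
    rewrite RintegralB//; last exact: (integrableZl measurableT (c0 / 2) intk).
    by rewrite RintegralZl// k0 mulr0 subr0 Rintegral_probability_cst normr1.
  apply: (@le_trans _ _ (3%:E * I1)%E).
    by rewrite I1E -EFinM lee_fin; lra.
  by rewrite -!addeA leeDl// !adde_ge0// lee_fin (le_trans c1d_ge0).
have delta_gt0 : 0 < delta by rewrite lt_def d_neq0.
(* For [delta > 0] an infinite [I3] makes the whole bound infinite. For [delta = 0] the convention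
   [0 * +oo = 0] would erase that term, hence the separate case before. *)
have [I3y|I3_fin] := eqVneq I3 +oo%E.
  rewrite I3y gt0_muley ?lte_fin; last by rewrite ltr_wpDr// divr_ge0.
  rewrite addye// gt0_muley ?lte_fin ?mulr_gt0 ?exprn_gt0//.
  rewrite addey ?leey// -ltNye (lt_le_trans ltNy0)//.
  by rewrite !adde_ge0// lee_fin (le_trans c1d_ge0).
have int_cg : P.-integrable setT (EFin \o (fun w => c0 * g (W w))).
  apply/integrableP; split.
    apply/measurable_EFinP; apply: measurable_funM => //; exact: measurableT_comp.
  by rewrite ltey.
have intg : P.-integrable setT (EFin \o (g \o W)).
  have := integrableZl measurableT c0^-1 int_cg; congr (integrable P setT _).
  by apply/funext => w /=; rewrite -EFinM mulKf// gt_eqF.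
(* Only the sum [g(W) + r(W)] is integrable by assumption; finiteness of [I3] separates the two
   terms. *)
have intr : P.-integrable setT (EFin \o (r \o W)).
  have [_ [_ [h _]]] := condW.
  have := integrableB measurableT h intg; congr (integrable P setT _).
  by apply/funext => w /=; rewrite -EFinB; congr EFin; ring.
have I2E : I2 = (Rintegral P setT (fun w => `|r (W w)|))%:E.
  rewrite /Rintegral fineK//.
  exact: (integrable_fin_num measurableT (integrable_abse intr)).
have I3E : I3 = (Rintegral P setT (fun w => `|c0 * g (W w)|))%:E.
  rewrite /Rintegral fineK//.
  exact: (integrable_fin_num measurableT (integrable_abse int_cg)).
have int_ncg := integrable_abse int_cg.
move: I1_ge0 I2_ge0 I3_ge0; rewrite I1E I2E I3E -!(EFinM, EFinD) !lee_fin.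
set e1 := Rintegral P setT _; set e2 := Rintegral P setT _; set e3 := Rintegral P setT _.
move=> e1_ge0 e2_ge0 e3_ge0.
pose q := gibbs_density c0 c1 g; rewrite -/q in law.
pose u x := c0 * g x.
pose L := lip_const c1 c3 u.
have i1 := integrable_probability_cst P (5 / 6 * (c1 * c3)).
have intL : P.-integrable setT (EFin \o (L \o W)).
  exact: (integrableD measurableT i1 (integrableZl measurableT (3 / 2) int_ncg)).
have EL : Rintegral P setT (L \o W) = 5 / 6 * (c1 * c3) + 3 / 2 * e3.
  rewrite RintegralD//; last exact: (integrableZl measurableT (3 / 2) int_ncg).
  by rewrite (Rintegral_probability_cst P) RintegralZl.
have cd1 : c1 * delta <= 1 by rewrite (le_trans K_ge)// ltW.
have cd3 : c1 * c3 * delta <= 1 by rewrite (le_trans K_ge3)// ltW.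
have mf y : measurable_fun setT (stein_sol q F y).
  by apply: continuous_measurable_fun; exact: continuous_stein_sol law y.
have f_le y x : `|stein_sol q F y x| <= 1 / c1.
  by rewrite ger0_norm; [exact: stein_sol_le law y x|exact: stein_sol_ge0 law y x].
have disc y s := @smoothed_discrepancy _ _ _ P W W' g r k (stein_sol q F y) L
  c0 c1 delta z (F y) s mW mW' exch condW condW2 c0_gt0 dWW mg intg (mf y)
  (f_le y) (normr_drift_stein_sol law y) (cdf_bound law y) intL.
have up : p - F (z + delta) <= 2 * e1 + c0 / c1 * e2
    + c0 / 2 * (delta ^+ 3 * (5 / 6 * (c1 * c3) + 3 / 2 * e3)).
  rewrite -EL -[leLHS]mul1r; apply: disc; first by left.
  move=> w; rewrite !mul1r.
  exact: (stein_pair_ge law c3_ge0 du_bound delta_ge0 cd1 cd3 z (dWW w)).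
have down : - (p - F (z - delta)) <= 2 * e1 + c0 / c1 * e2
    + c0 / 2 * (delta ^+ 3 * (5 / 6 * (c1 * c3) + 3 / 2 * e3)).
  rewrite -EL -[leLHS]mulN1r; apply: disc; first by right.
  move=> w; rewrite !mulN1r.
  rewrite -opprD lerN2.
  exact: (stein_pair_le law c3_ge0 du_bound delta_ge0 cd1 cd3 z (dWW w)).
have Fup : F (z + delta) - F z <= c1 * delta.
  have := @cdf_lipschitz _ _ _ _ _ _ law z (z + delta).
  by rewrite addrAC subrr add0r lerDl; apply.
have Fdown : F z - F (z - delta) <= c1 * delta.
  by have := @cdf_lipschitz _ _ _ _ _ _ law (z - delta) z; rewrite subKr gerBl; apply.
(* The constants obtained are smaller than those claimed: 2 against 3, 1 against 2 for [r], and half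
   of 5/6 and of 3/2 against 1/2 and [2 + c3 / 2]. These nonnegative products supply the slack. *)
have n1 : 0 <= delta ^+ 3 * c0 * e3 by rewrite mulr_ge0.
have n2 : 0 <= delta ^+ 3 * c0 * e3 * c3 by rewrite mulr_ge0.
have n3 : 0 <= delta ^+ 3 * c0 * (c1 * c3) by rewrite !mulr_ge0// ltW.
have n4 : 0 <= c0 / c1 * e2 by rewrite mulr_ge0// divr_ge0// ltW.
by rewrite ler_norml; apply/andP; split; lra.
Qed.
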